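(* Let $(X,d)$ be a complete metric space. Then the following are equivalent: (1) $X$ admits a conical bicombing; (2) $X$ is a barycentric metric space, i.e. there exists a contracting barycenter map $\beta\colon P_1(X)\to X$.
   Context: A bicombing on $(X,d)$ is a map $\sigma\colon X\times X\times[0,1]\to X$ such that each $\sigma_{xy}:=\sigma(x,y,\cdot)$ is a geodesic from $x$ to $y$ ($\sigma_{xy}(0)=x$, $\sigma_{xy}(1)=y$, $d(\sigma_{xy}(s),\sigma_{xy}(t))=|s-t|d(x,y)$); it is conical if $d(\sigma_{xy}(t),\sigma_{x'y'}(t))\le(1-t)d(x,x')+t\,d(y,y')$ for all $x,y,x',y'\in X$, $t\in[0,1]$. $P_1(X)$ denotes the set of Radon probability measures $\mu$ on $X$ with $W_1(\mu,\delta_{x_0})<\infty$ for some (equivalently every) $x_0\in X$, equipped with the first Wasserstein distance $W_1(\mu,\nu)=\inf_{\gamma}\int_{X\times X}d(x,y)\,d\gamma(x,y)$, the infimum over all couplings $\gamma$ of $(\mu,\nu)$ (probability measures on $X\times X$ with marginals $\mu$ and $\nu$). A contracting barycenter map is a 1-Lipschitz map $\beta\colon (P_1(X),W_1)\to X$ with $\beta(\delta_x)=x$ for all $x\in X$. *)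

(* Defs.v *)
From HB Require Import structures.
From mathcomp Require Import all_boot all_order all_algebra.
From mathcomp Require Import all_classical all_reals all_analysis.
Set Implicit Arguments. Unset Strict Implicit. Unset Printing Implicit Defensive.
Import Order.TTheory GRing.Theory Num.Theory.
Local Open Scope classical_set_scope.
Local Open Scope ring_scope.

Section MetricDefs.
Variables (R : realType) (X : pointedType).
Implicit Types (d : X -> X -> R).

Definition is_metric d : Prop :=
  (forall x y, d x y = 0 <-> x = y) /\
  (forall x y, d x y = d y x) /\
  (forall x y z, d x z <= d x y + d y z).

Definition is_complete d : Prop :=
  forall u : nat -> X,
    (forall e : R, 0 < e -> exists N, forall m n, (N <= m)%N -> (N <= n)%N -> d (u m) (u n) < e) ->
    exists l : X, forall e : R, 0 < e -> exists N, forall n, (N <= n)%N -> d (u n) l < e.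

Definition mopen d (U : set X) : Prop :=
  forall x, U x -> exists2 r : R, 0 < r & [set y | d x y < r] `<=` U.

Definition mcompact d (K : set X) : Prop :=
  forall (I : Type) (U : I -> set X), (forall i, mopen d (U i)) ->
    K `<=` \bigcup_i U i ->
    exists2 F : set I, finite_set F & K `<=` \bigcup_(i in F) U i.

Definition is_geodesic d (x y : X) (c : R -> X) : Prop :=
  c 0 = x /\ c 1 = y /\
  forall s t, 0 <= s <= 1 -> 0 <= t <= 1 -> d (c s) (c t) = `|s - t| * d x y.

Definition conical_bicombing d (sigma : X -> X -> R -> X) : Prop :=
  (forall x y, is_geodesic d x y (sigma x y)) /\
  (forall x y x' y' t, 0 <= t <= 1 ->
     d (sigma x y t) (sigma x' y' t) <= (1 - t) * d x x' + t * d y y').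

End MetricDefs.

Definition borel (R : realType) (X : pointedType) (d : X -> X -> R) :=
  g_sigma_algebraType (mopen d).

(* the sum metric on X * X, inducing the product topology *)
Definition dprod (R : realType) (X : pointedType) (d : X -> X -> R)
  (p q : X * X) : R := d p.1 q.1 + d p.2 q.2.

Section Measures.
Variables (R : realType) (X : pointedType) (d : X -> X -> R).
Local Open Scope ereal_scope.

Definition radon_prob (Y : pointedType) (e : Y -> Y -> R)
  (mu : {measure set (borel e) -> \bar R}) : Prop :=
  mu setT = 1 /\
  forall B : set (borel e), measurable B ->
    mu B = ereal_sup [set mu K | K in [set K : set Y | mcompact e K /\ K `<=` B]].

Definition P1 (mu : {measure set (borel d) -> \bar R}) : Prop :=
  radon_prob mu /\
  exists x0 : X, \int[mu]_x (d x0 x)%:E < +oo.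

Definition coupling (mu nu : {measure set (borel d) -> \bar R})
  (g : {measure set (borel (dprod d)) -> \bar R}) : Prop :=
  radon_prob g /\
  (forall A : set (borel d), measurable A -> g (fst @^-1` A) = mu A) /\
  (forall A : set (borel d), measurable A -> g (snd @^-1` A) = nu A).

Definition W1 (mu nu : {measure set (borel d) -> \bar R}) : \bar R :=
  ereal_inf [set \int[g]_p (d p.1 p.2)%:E | g in coupling mu nu].

Definition contracting_barycenter_map
  (beta : {measure set (borel d) -> \bar R} -> X) : Prop :=
  (forall x : X, beta (\d_(x : borel d)) = x) /\
  (forall mu nu, P1 mu -> P1 nu -> (d (beta mu) (beta nu))%:E <= W1 mu nu).

Definition barycentric : Prop :=
  exists beta, contracting_barycenter_map beta.

End Measures.

(* Main.v *)
(* From a bicombing to a barycenter map.  Replacing each of [n+2] points by the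
   mean of the other [n+1] is a contraction towards the diagonal, so iterating
   it turns a symmetric mean of [n+1] points into one of [n+2] points; for two
   points one uses [x, y |-> sigma x y (1/2), sigma y x (1/2)] instead, which
   halves the distance by conicality.  These means are symmetric and
   [1/n]-Lipschitz in each variable, hence the means of two independent
   [n]-samples of a finitely supported law get close (their letter counts
   agree up to [O(sqrt n)]), while the expected distance from a fixed point to
   the mean of an [n]-sample decreases with [n]; the sampled means therefore
   concentrate at a point, the barycenter of the law.  It depends only on the
   law and is 1-Lipschitz along finite couplings.  A Radon measure of finite
   first moment is approximated by the laws of finitely valued maps [X -> X]
   close to the identity, and composing such maps with the projections of a
   coupling avoids any gluing of couplings.

   Conversely, [sigma x y t] is the barycenter of
   [(1 - t) delta_x + t delta_y]. *)
From HB Require Import structures.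
Require Import Defs.
From mathcomp Require Import all_boot all_order all_algebra.
From mathcomp Require Import all_classical all_reals all_analysis.
From mathcomp Require Import measurable_realfun perm ring lra.
Set Implicit Arguments. Unset Strict Implicit. Unset Printing Implicit Defensive.
Import Order.TTheory GRing.Theory Num.Theory.
Import numFieldNormedType.Exports.
Local Open Scope classical_set_scope.
Local Open Scope ring_scope.

(** * Limits of contracting iterations *)

Section MetricLimits.
Variables (R : realType) (X : pointedType) (d : X -> X -> R).
Hypothesis dm : is_metric d.

Lemma dist_eq0 x y : d x y = 0 -> x = y. Proof. by move/(dm.1 x y). Qed.
Lemma distxx x : d x x = 0. Proof. exact/(dm.1 x x). Qed.
Lemma distC x y : d x y = d y x. Proof. exact: dm.2.1. Qed.
Lemma dist_triangle y x z : d x z <= d x y + d y z.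
Proof. exact: dm.2.2. Qed.

Lemma dist_ge0 x y : 0 <= d x y.
Proof.
have := dist_triangle y x x; rewrite distxx (distC y x) => h; lra.
Qed.

Definition mcvg (u : nat -> X) (l : X) :=
  forall e : R, 0 < e -> exists N, forall n, (N <= n)%N -> d (u n) l < e.

Definition mlim (u : nat -> X) : X := xget point [set l | mcvg u l].

Lemma mcvg_unique u l l' : mcvg u l -> mcvg u l' -> l = l'.
Proof.
move=> ul ul'; apply: dist_eq0; apply/eqP; rewrite eq_le dist_ge0 andbT.
apply/ler_addgt0Pr => e e0; rewrite add0r.
have [N hN] := ul _ (divr_gt0 e0 (ltr0n R 2)).
have [N' hN'] := ul' _ (divr_gt0 e0 (ltr0n R 2)).
have := hN _ (leq_maxl N N'); have := hN' _ (leq_maxr N N').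
have := dist_triangle (u (maxn N N')) l l'; rewrite (distC l (u _)).
move: (d _ l) (d _ l') => a b; lra.
Qed.

Lemma mlimP u l : mcvg u l -> mcvg u (mlim u).
Proof. by move=> ul; apply: (xgetPex point); exists l. Qed.

Lemma mlimE u l : mcvg u l -> mlim u = l.
Proof. by move=> ul; apply: mcvg_unique (mlimP ul) ul. Qed.

Hypothesis dc : is_complete d.

(** * Iterated maps on tuples whose diameters shrink geometrically *)

Section Iteration.
Variables (n : nat) (T : ('I_n.+1 -> X) -> 'I_n.+1 -> X).
Hypothesis T_hull : forall x z r,
  (forall i, d (x i) z <= r) -> forall i, d (T x i) z <= r.
Hypothesis T_diam : forall x r,
  (forall i j, d (x i) (x j) <= r) -> forall i j, d (T x i) (T x j) <= r / 2.

Definition iter_lim x := mlim (fun k => iter k T x ord0).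

(** The [k]-th iterate has diameter at most [r / 2 ^ k], and by [T_hull] later iterates stay that
    close to each of its entries; so coordinate [ord0] is Cauchy and the other coordinates share its
    limit. *)
Lemma iter_limP x e : 0 < e ->
  exists N, forall k, (N <= k)%N -> forall i, d (iter k T x i) (iter_lim x) < e.
Proof.
pose r := \sum_i \sum_j d (x i) (x j).
have r0 : 0 <= r by apply: sumr_ge0 => i _; apply: sumr_ge0 => j _; exact: dist_ge0.
have hr i j : d (x i) (x j) <= r.
  rewrite /r (bigD1 i)//= (bigD1 j)//= -addrA lerDl addr_ge0//.
    by apply: sumr_ge0 => *; exact: dist_ge0.
  by do 2![apply: sumr_ge0 => *]; exact: dist_ge0.
have diam k i j : d (iter k T x i) (iter k T x j) <= r * 2^-1 ^+ k.
  elim: k i j => [|k IH] i j; first by rewrite expr0 mulr1.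
  by rewrite exprSr mulrA /=; exact: T_diam.
have hull k m i j : d (iter (m + k) T x j) (iter k T x i) <= r * 2^-1 ^+ k.
  by elim: m j => [|m IH] j; [exact: diam|rewrite addSn /=; exact: T_hull].
have hull' k m i j : (k <= m)%N ->
    d (iter m T x j) (iter k T x i) <= r * 2^-1 ^+ k.
  by move=> /subnK <-; exact: hull.
have small e' : 0 < e' -> exists N, r * 2^-1 ^+ N < e'.
  move=> e0.
  exists (Num.bound (r / e')); set M := Num.bound _.
  have : r / e' < M%:R by apply: archi_boundP; rewrite divr_ge0// ltW.
  have M2 : M%:R < 2 ^+ M :> R by rewrite -natrX ltr_nat ltn_expl.
  move=> /lt_trans /(_ M2); rewrite exprVn ltr_pdivrMr// => h.
  by rewrite ltr_pdivrMr ?exprn_gt0// mulrC.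
have [|l hl] := @dc (fun k => iter k T x ord0).
  move=> e' e0; have [N hN] := small _ (divr_gt0 e0 (ltr0n R 2)).
  exists N => m k hm hk; apply: le_lt_trans (dist_triangle (iter N T x ord0) _ _) _.
  have := hull' _ _ ord0 ord0 hm; have := hull' _ _ ord0 ord0 hk.
  rewrite (distC _ (iter k T x _)); move: (d _ _) (d _ _) => a b; lra.
have {}hl := mlimP hl; rewrite -/(iter_lim x) in hl => e0.
have [N hN] := small _ (divr_gt0 e0 (ltr0n R 2)).
have [N' hN'] := hl _ (divr_gt0 e0 (ltr0n R 2)).
exists N => k hk i; pose M := maxn k N'.
have := hN' M (leq_maxr _ _).
have := dist_triangle (iter k T x i) (iter M T x ord0) (iter_lim x).
have := dist_triangle (iter M T x ord0) (iter k T x i) (iter_lim x).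
have := hull' _ _ i ord0 (leq_maxl k N'); rewrite -/M (distC (iter M T x _)).
have : r * 2^-1 ^+ k <= r * 2^-1 ^+ N.
  by rewrite ler_wpM2l// ler_wiXn2l// ?invr_ge0// invf_le1 ?ler1n.
move: (d _ _) (d _ _) (d _ _) => *; lra.
Qed.

Lemma iter_lim_step x : iter_lim (T x) = iter_lim x.
Proof.
apply: mlimE => e /(iter_limP x)[N hN]; exists N => k hk.
by rewrite -iterSr; apply: hN; exact: leqW.
Qed.

Lemma iter_lim_const c : T (fun=> c) = (fun=> c) -> iter_lim (fun=> c) = c.
Proof.
move=> Tc; apply: mlimE => e e0; exists 0%N => k _.
suff -> : iter k T (fun=> c) = (fun=> c) by rewrite distxx.
by elim: k => //= k ->.
Qed.

Lemma iter_lim_comp (f : 'I_n.+1 -> 'I_n.+1) x :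
  (forall y, T (y \o f) = T y \o f) -> iter_lim (x \o f) = iter_lim x.
Proof.
move=> Tf; apply: mlimE => e /(iter_limP x)[N hN]; exists N => k hk.
suff -> : iter k T (x \o f) = iter k T x \o f by exact: hN.
by elim: k {hk} => //= k ->.
Qed.

(** [T] does not increase the sum of distances, and both orbits converge to constant tuples, for
    which that sum is [n.+1] times the distance of the limits. *)
Lemma iter_lim_lipschitz x y :
  (forall x y, \sum_i d (T x i) (T y i) <= \sum_i d (x i) (y i)) ->
  n.+1%:R * d (iter_lim x) (iter_lim y) <= \sum_i d (x i) (y i).
Proof.
move=> TL; apply/ler_addgt0Pr => e e0.
have n0 : 0 < n.+1%:R :> R by rewrite ltr0n.
have [a a0 ->] : exists2 a, 0 < a & e = n.+1%:R * a.
  by exists (e / n.+1%:R); [rewrite divr_gt0|rewrite mulrC divfK ?gt_eqF].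
have a1 : 0 < a / 2 by rewrite divr_gt0.
have [N hN] := iter_limP x a1; have [N' hN'] := iter_limP y a1.
pose M := maxn N N'; set lx := iter_lim x; set ly := iter_lim y.
have : \sum_i d (iter M T x i) (iter M T y i) <= \sum_i d (x i) (y i).
  by elim: M => //= k; exact: le_trans (TL _ _).
have : \sum_(i < n.+1) d lx ly <=
    \sum_(i < n.+1) (d (iter M T x i) (iter M T y i) + a).
  apply: ler_sum => i _.
  have := hN M (leq_maxl _ _) i; have := hN' M (leq_maxr _ _) i.
  have := dist_triangle (iter M T x i) lx ly.
  have := dist_triangle (iter M T y i) (iter M T x i) ly.
  rewrite (distC lx (iter M T x i)) -/lx -/ly.
  set u := iter M T x i; set v := iter M T y i; lra.
rewrite big_split/= !sumr_const card_ord -(mulr_natl (d lx ly)) -(mulr_natl a).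
by move=> h1 h2; lra.
Qed.

End Iteration.
End MetricLimits.

(** * Symmetric means *)

Section SymmetricMeans.
Variables (R : realType) (X : pointedType) (d : X -> X -> R).
Hypothesis dm : is_metric d.

(** An injective self-map of ['I_n.+1] is a permutation, so the last clause is symmetry. *)
Definition symmetric_mean n (B : ('I_n.+1 -> X) -> X) :=
  [/\ forall x y, n.+1%:R * d (B x) (B y) <= \sum_i d (x i) (y i),
      forall c, B (fun=> c) = c
    & forall f x, injective f -> B (x \o f) = B x].

(** [g] is the bijection that [f] induces from the indices other than [i] to those other than
    [f i]. *)
Lemma lift_conj n (f : 'I_n.+2 -> 'I_n.+2) i : injective f ->
  exists2 g : 'I_n.+1 -> 'I_n.+1, injective g &
    f \o lift i = lift (f i) \o g.
Proof.
move=> fi.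
have ex j : exists k, f (lift i j) = lift (f i) k.
  case: (unliftP (f i) (f (lift i j))) => [k ->|/fi /eqP]; first by exists k.
  by rewrite eq_sym (negbTE (neq_lift i j)).
have [g hg] := choice ex; exists g; last exact/funext.
by move=> j k gjk; apply/(@lift_inj _ i)/fi; rewrite !hg gjk.
Qed.

Lemma symmetric_mean_hull n (B : ('I_n.+1 -> X) -> X) x z r : symmetric_mean B ->
  (forall i, d (x i) z <= r) -> d (B x) z <= r.
Proof.
move=> [BL Bc _] h; have := BL x (fun=> z); rewrite Bc => h1.
have n0 : 0 < n.+1%:R :> R by rewrite ltr0n.
rewrite -(ler_pM2l n0); apply: le_trans h1 _.
apply: (@le_trans _ _ (\sum_(i < n.+1) r)); first exact: ler_sum.
by rewrite sumr_const card_ord mulr_natl.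
Qed.

Variable sigma : X -> X -> R -> X.
Hypothesis cb : conical_bicombing d sigma.

Lemma bicombing_id x t : 0 <= t <= 1 -> sigma x x t = x.
Proof.
move=> t01; have [c0 [_ cd]] := cb.1 x x; apply: (dist_eq0 dm).
by have := cd t 0 t01; rewrite c0 (distxx dm) mulr0; apply; rewrite lexx ler01.
Qed.

Lemma half01 : 0 <= (2^-1 : R) <= 1. Proof. lra. Qed.

Lemma conical_half x y x' y' :
  d (sigma x y 2^-1) (sigma x' y' 2^-1) <= (d x x' + d y y') / 2.
Proof. by have := cb.2 x y x' y' _ half01; lra. Qed.

(* For two points, deleting one of them is not a contraction, hence the
   exceptional use of [sigma] when [n = 0]. *)
Definition leave_one_out n (B : ('I_n.+1 -> X) -> X) (x : 'I_n.+2 -> X) i :=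
  if n == 0%N then sigma (x i) (B (x \o lift i)) 2^-1 else B (x \o lift i).

(** * Deletion of one point as a contraction towards the diagonal *)

Section LeaveOneOut.
Variables (n : nat) (B : ('I_n.+1 -> X) -> X).
Hypothesis Bm : symmetric_mean B.
Let T := leave_one_out B.

Lemma leave_one_out_hull x z r :
  (forall i, d (x i) z <= r) -> forall i, d (T x i) z <= r.
Proof.
move=> h i; have hB : d (B (x \o lift i)) z <= r.
  by apply: (symmetric_mean_hull Bm) => j; exact: h.
rewrite /T /leave_one_out; case: (n == 0%N) => //.
have := conical_half (x i) (B (x \o lift i)) z z.
by rewrite (bicombing_id _ half01); have := h i; lra.
Qed.

Lemma leave_one_out_const c : T (fun=> c) = (fun=> c).
Proof.
apply/funext => i; rewrite /T /leave_one_out.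
have [_ Bc _] := Bm; have -> : B ((fun=> c) \o lift i) = c by exact: Bc.
by rewrite (bicombing_id _ half01) if_same.
Qed.

Lemma leave_one_out_comp f : injective f -> forall x, T (x \o f) = T x \o f.
Proof.
move=> fi x; apply/funext => i; rewrite /T /leave_one_out /=.
have [g gi fg] := lift_conj i fi; have [_ _ Bs] := Bm.
suff -> : B ((x \o f) \o lift i) = B (x \o lift (f i)) by [].
by rewrite -compA fg compA Bs.
Qed.

(** Double counting: each index survives every deletion but its own, that is [n.+1] of the
    [n.+2]. *)
Lemma sum_leave_one_out (g : 'I_n.+2 -> R) :
  \sum_i \sum_j g (lift i j) = n.+1%:R * \sum_i g i.
Proof.
have lE i : \sum_j g (lift i j) = \sum_k g k - g i.
  by rewrite [in RHS](bigD1_ord i)//= addrC addrK.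
rewrite (eq_bigr _ (fun i _ => lE i)) sumrB sumr_const card_ord.
by rewrite -(mulr_natl (\sum_k g k)) -natr1; ring.
Qed.

Lemma leave_one_out_lipschitz x y :
  \sum_i d (T x i) (T y i) <= \sum_i d (x i) (y i).
Proof.
have [BL _ _] := Bm.
have n0 : 0 < n.+1%:R :> R by rewrite ltr0n.
have h : \sum_i d (B (x \o lift i)) (B (y \o lift i)) <= \sum_i d (x i) (y i).
  rewrite -(ler_pM2l n0) -(sum_leave_one_out (fun i => d (x i) (y i))) mulr_sumr.
  by apply: ler_sum => i _; exact: BL.
rewrite /T /leave_one_out; case: (n == 0%N) => //.
apply: (@le_trans _ _
  (\sum_i (d (x i) (y i) + d (B (x \o lift i)) (B (y \o lift i))) / 2)).
  by apply: ler_sum => i _; exact: conical_half.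
rewrite -mulr_suml big_split/=; lra.
Qed.

(** Up to order, the tuples without [x i] and without [x j] differ in a single entry, which is [x j]
    in one and [x i] in the other. Their means are thus within [r / n.+1], which is at most [r / 2]
    as soon as [0 < n]. *)
Lemma leave_one_out_diam x r :
  (forall i j, d (x i) (x j) <= r) -> forall i j, d (T x i) (T x j) <= r / 2.
Proof.
move=> h i j; have r0 : 0 <= r by apply: le_trans (h i i); rewrite (distxx dm).
have [->|ij] := eqVneq i j; first by rewrite (distxx dm); lra.
have [BL _ _] := Bm.
have n0 : 0 < n.+1%:R :> R by rewrite ltr0n.
have [k0 k0P] : exists k, lift i k = j.
  by case: (unliftP i j) ij => [k ->|->]; [exists k|rewrite eqxx].
have Bij : n.+1%:R * d (B (x \o lift i)) (B (x \o lift j)) <= r.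
  have [g gi fg] := lift_conj i (@perm_inj _ (tperm i j)).
  have <- : B (x \o (tperm i j \o lift i)) = B (x \o lift j).
    have [_ _ Bs] := Bm.
    by rewrite fg tpermL -[x \o (_ \o g)]/((x \o lift j) \o g) Bs.
  apply: le_trans (BL _ _) _; rewrite (bigD1 k0)//= big1 ?addr0//.
  move=> k kk0; rewrite tpermD ?(distxx dm)// ?neq_lift//.
  by rewrite -k0P (inj_eq lift_inj) eq_sym.
rewrite /T /leave_one_out; case: n B Bm BL x h i j ij n0 k0 k0P Bij
    => [|m] B' Bm' BL x h i j ij n0 k0 k0P Bij.
(* With [n = 0] a deletion leaves one point, and its mean is that point. *)
- have Bx a b : a != b -> B' (x \o lift a) = x b.
    move=> ab; have [_ Bc _] := Bm'.
    rewrite -[RHS]Bc; congr B'; apply/funext => k /=; congr x.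
    case: (unliftP a b) ab => [k' -> _|->]; last by rewrite eqxx.
    by rewrite !ord1.
  rewrite (Bx _ _ ij) (Bx j i) 1?eq_sym//.
  (* Conicality against the constant geodesic at [sigma (x j) (x i) 2^-1],
     which is at distance at most [r / 2] from both [x i] and [x j]. *)
  have := conical_half (x i) (x j) (sigma (x j) (x i) 2^-1) (sigma (x j) (x i) 2^-1).
  have := conical_half (x i) (x i) (x j) (x i).
  have := conical_half (x j) (x j) (x j) (x i).
  rewrite !(bicombing_id _ half01) !(distxx dm).
  by have := h i j; have := h j i; lra.
- have m2 : 2 <= m.+2%:R :> R by rewrite ler_nat.
  have := ler_wpM2r (dist_ge0 dm (B' (x \o lift i)) (B' (x \o lift j))) m2; lra.
Qed.

Hypothesis dc : is_complete d.

Lemma symmetric_mean_step : symmetric_mean (iter_lim d T).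
Proof.
split=> [x y|c|f x fi].
- apply: (iter_lim_lipschitz dm dc leave_one_out_hull leave_one_out_diam).
  exact: leave_one_out_lipschitz.
- exact: (iter_lim_const dm (leave_one_out_const c)).
- apply: (iter_lim_comp dm dc leave_one_out_hull leave_one_out_diam).
  exact: leave_one_out_comp.
Qed.

(** One more step does not move the limit, so [z] can be compared with the limit of [T x], whose
    entries for [0 < n] are the means with one point left out. *)
Lemma iter_lim_leave_one_out_mono x z : (0 < n)%N ->
  n.+2%:R * d (iter_lim d T x) z <= \sum_i d (B (x \o lift i)) z.
Proof.
move=> n0; have [SL Sc _] := symmetric_mean_step.
rewrite -(iter_lim_step dm dc leave_one_out_hull leave_one_out_diam).
rewrite -{1}(Sc z); apply: le_trans (SL _ _) _.
by rewrite /T /leave_one_out eqn0Ngt n0.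
Qed.

End LeaveOneOut.

Fixpoint smean n : ('I_n.+1 -> X) -> X :=
  if n is m.+1 then iter_lim d (leave_one_out (@smean m)) else fun x => x ord0.

Hypothesis dc : is_complete d.

Lemma smeanP n : symmetric_mean (@smean n).
Proof.
elim: n => [|n IH]; last exact: symmetric_mean_step.
split=> //= [x y|f x _]; first by rewrite mul1r big_ord1.
by congr x; rewrite !ord1.
Qed.

(** The empty word gets the value [point], which is harmless because only long words matter in the
    limit. *)
Definition seq_mean (s : seq X) : X :=
  @smean (size s).-1 (fun i => nth point s i).

Lemma seq_meanE n s : size s = n.+1 ->
  seq_mean s = @smean n (fun i => nth point s i).
Proof. by rewrite /seq_mean => ->. Qed.

Lemma seq_mean_lipschitz n s t : size s = n.+1 -> size t = n.+1 ->
  n.+1%:R * d (seq_mean s) (seq_mean t) <=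
  \sum_(i < n.+1) d (nth point s i) (nth point t i).
Proof.
by move=> ss st; rewrite (seq_meanE ss) (seq_meanE st); have [h _ _] := smeanP n.
Qed.

Lemma seq_mean_const n c : seq_mean (nseq n.+1 c) = c.
Proof.
have [_ h _] := smeanP n; rewrite (@seq_meanE n) ?size_nseq// -[RHS]h.
by congr smean; apply/funext => i; rewrite nth_nseq ltn_ord.
Qed.

Lemma seq_mean_perm s t : (0 < size s)%N -> perm_eq s t -> seq_mean s = seq_mean t.
Proof.
move=> s0 st; have sz := perm_size st.
have es : size s = (size s).-1.+1 by rewrite prednK.
move: (size s).-1 es => n es; have et : size t = n.+1 by rewrite -sz.
rewrite (seq_meanE es) (seq_meanE et).
have [Is Ip sE] := elimT (perm_iotaP point) st.
have sI : size Is = n.+1 by rewrite (perm_size Ip) size_iota.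
have ltI (i : 'I_n.+1) : (nth 0 Is i < n.+1)%N.
  have : nth 0%N Is i \in iota 0 (size t).
    by rewrite -(perm_mem Ip) mem_nth// sI.
  by rewrite mem_iota et.
pose f i := Ordinal (ltI i).
have fi : injective f.
  move=> i j /(congr1 val)/= /eqP; rewrite nth_uniq ?sI//.
    by move/eqP/val_inj.
  by rewrite (perm_uniq Ip) iota_uniq.
have [_ _ h] := smeanP n; rewrite -[RHS](h _ _ fi); congr smean.
by apply/funext => i /=; rewrite sE (nth_map 0%N) ?sI.
Qed.

Definition remat T i (s : seq T) := take i s ++ drop i.+1 s.

(** The sizes start at three, as the mean of two points involves [sigma] and not only the
    leave-one-out means. *)
Lemma seq_mean_mono n s z : size s = n.+3 ->
  n.+3%:R * d (seq_mean s) z <= \sum_(i < n.+3) d (seq_mean (remat i s)) z.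
Proof.
move=> ss; rewrite (seq_meanE ss).
have -> : \sum_(i < n.+3) d (seq_mean (remat i s)) z =
    \sum_(i < n.+3) d (@smean n.+1 ((fun i => nth point s i) \o lift i)) z.
  apply: eq_bigr => i _; have li : (i < size s)%N by rewrite ss.
  have sr : size (remat i s) = n.+2.
    rewrite /remat size_cat size_takel 1?ltnW// size_drop ss subSS.
    by rewrite subnKC// -ltnS.
  rewrite (seq_meanE sr); congr (d (smean _) z); apply/funext => j /=.
  rewrite /remat nth_cat size_takel; last exact: ltnW.
  rewrite /bump; case: (ltnP j i) => [ji|ij]; first by rewrite nth_take// leqNgt ji.
  by rewrite nth_drop addSn subnKC// ij.
by apply: iter_lim_leave_one_out_mono => //; exact: smeanP.
Qed.

End SymmetricMeans.

(** * Barycenters of finitely supported laws *)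

Section WordExpectation.
Variables (R : realType) (I : finType) (p : I -> R).
Hypotheses (p_ge0 : forall i, 0 <= p i) (p_sum1 : \sum_i p i = 1).

(* Expectation of [F] over words of [n] independent letters of law [p]. *)
Fixpoint wexp n (F : seq I -> R) : R :=
  if n is m.+1 then \sum_i p i * wexp m (fun s => F (i :: s)) else F [::].

Lemma wexp_le n F G :
  (forall s, size s = n -> F s <= G s) -> wexp n F <= wexp n G.
Proof.
elim: n F G => [|n IH] F G FG /=; first exact: FG.
apply: ler_sum => i _; apply: ler_wpM2l => //.
by apply: IH => s ss; apply: FG; rewrite /= ss.
Qed.

Lemma eq_wexp n F G :
  (forall s, size s = n -> F s = G s) -> wexp n F = wexp n G.
Proof.
by move=> FG; apply: le_anti; rewrite !wexp_le// => s ss; rewrite FG.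
Qed.

Lemma wexp_affine n a b F :
  wexp n (fun s => a * F s + b) = a * wexp n F + b.
Proof.
elim: n F => [|n IH] F //=.
rewrite (eq_bigr (fun i => a * (p i * wexp n (fun s => F (i :: s))) + p i * b)).
  by rewrite big_split/= -mulr_sumr -mulr_suml p_sum1 mul1r.
by move=> i _; rewrite IH; ring.
Qed.

Lemma wexpD n F G : wexp n (fun s => F s + G s) = wexp n F + wexp n G.
Proof.
elim: n F G => [|n IH] F G //=; rewrite -big_split/=.
by apply: eq_bigr => i _; rewrite IH mulrDr.
Qed.

Lemma wexp_cst n b : wexp n (fun=> b) = b.
Proof.
by have := wexp_affine n 0 b (fun=> 0); rewrite !mul0r !add0r.
Qed.

Lemma wexp_sum (J : finType) n (F : J -> seq I -> R) :
  wexp n (fun s => \sum_j F j s) = \sum_j wexp n (F j).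
Proof.
elim: n F => [|n IH] F //=; rewrite exchange_big/=.
by apply: eq_bigr => i _; rewrite IH mulr_sumr.
Qed.

Lemma wexp_additive n g :
  wexp n (fun s => \sum_(a <- s) g a) = n%:R * \sum_i p i * g i.
Proof.
elim: n => [|n IH] /=; first by rewrite big_nil mul0r.
rewrite (eq_bigr (fun i => p i * g i + p i * (n%:R * \sum_i p i * g i))).
  by rewrite big_split/= -mulr_suml p_sum1 -natr1; ring.
move=> i _; rewrite -IH -mulrDr; congr (_ * _).
rewrite -[RHS]addrC -[in RHS](mul1r (wexp _ _)) -wexp_affine; apply: eq_wexp.
by move=> s _; rewrite big_cons mul1r addrC.
Qed.

(** The letters are independent with total mass 1, so the deleted one integrates out. *)
Lemma wexp_remat n i F : (i <= n)%N ->
  wexp n.+1 (fun s => F (remat i s)) = wexp n F.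
Proof.
elim: n i F => [|n IH] i F.
  rewrite leqn0 => /eqP ->.
  by rewrite /= /remat/= (eq_bigr (fun i => p i * F [::]))// -mulr_suml p_sum1 mul1r.
case: i => [_|i]; last first.
  rewrite ltnS => lin; rewrite [LHS]/= [RHS]/=; apply: eq_bigr => j _.
  by rewrite -(IH i (fun s => F (j :: s)) lin).
transitivity (\sum_j p j * wexp n.+1 F); last by rewrite -mulr_suml p_sum1 mul1r.
by rewrite [LHS]/=; apply: eq_bigr => j _; congr (_ * _).
Qed.

(** If every choice of the first letter gave an expectation above [c], the weighted excesses would
    be nonnegative with sum at most 0, so that all weights would vanish, against [p_sum1]. *)
Lemma wexp_le_exists n F c : wexp n F <= c -> exists2 s, size s = n & F s <= c.
Proof.
elim: n F => [|n IH] F /=; first by exists [::].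
move=> h; suff [i hi] : exists i, wexp n (fun s => F (i :: s)) <= c.
  by have [s ss hs] := IH _ hi; exists (i :: s) => //=; rewrite ss.
apply: contrapT => /forallNP hn.
have hn' i : 0 < wexp n (fun s => F (i :: s)) - c.
  by rewrite subr_gt0 ltNge; apply/negP/hn.
have : \sum_i p i * (wexp n (fun s => F (i :: s)) - c) <= 0.
  rewrite (eq_bigr (fun i => p i * wexp n (fun s => F (i :: s)) - p i * c)).
    by rewrite sumrB -mulr_suml p_sum1 mul1r subr_le0.
  by move=> i _; rewrite mulrBr.
have ge i : 0 <= p i * (wexp n (fun s => F (i :: s)) - c).
  by rewrite mulr_ge0// ltW.
move=> le0; have /eqP : \sum_i p i * (wexp n (fun s => F (i :: s)) - c) == 0.
  by rewrite eq_le le0 sumr_ge0.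
move/psumr_eq0P => /(_ (fun i _ => ge i)) eq0.
have p0 i : p i = 0.
  by have /eqP := eq0 i isT; rewrite mulf_eq0 (gt_eqF (hn' i)) orbF => /eqP.
move: p_sum1; rewrite big1 => [/esym/eqP|i _]; last exact: p0.
by rewrite oner_eq0.
Qed.

(* Second moment of the number of occurrences of [i], with a shift [u] that
   makes the induction go through. *)
Lemma wexp_count_sqr n i u :
  wexp n (fun s => (u + (count_mem i s)%:R - n%:R * p i) ^+ 2) <= u ^+ 2 + n%:R.
Proof.
elim: n u => [|n IH] u /=; first by rewrite mul0r subr0 !addr0.
(* The first letter shifts [u] by the centred indicator [v]: its mean is 0, so the cross term drops
   out, and its square is at most 1, so each letter adds at most 1. *)
pose v (j : I) : R := (j == i)%:R - p i.
apply: (@le_trans _ _ (\sum_j p j * ((u + v j) ^+ 2 + n%:R))).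
  apply: ler_sum => j _; apply: ler_wpM2l => //; apply: le_trans (IH _).
  apply: wexp_le => s _; rewrite natrD -natr1 /v.
  by rewrite le_eqVlt; apply/orP; left; apply/eqP; ring.
have sv : \sum_j p j * v j = 0.
  rewrite (eq_bigr (fun j => p j * (j == i)%:R - p j * p i)); last first.
    by move=> j _; rewrite mulrBr.
  rewrite sumrB -mulr_suml p_sum1 mul1r (bigD1 i)//= eqxx mulr1 big1 ?addr0 ?subrr//.
  by move=> j /negbTE ->; rewrite mulr0.
have v1 j : v j ^+ 2 <= 1.
  have pi1 : p i <= 1 by rewrite -p_sum1 (bigD1 i)//= lerDl sumr_ge0.
  have pi0 := p_ge0 i; have : 0 <= p i * (1 - p i) by rewrite mulr_ge0// subr_ge0.
  by rewrite /v expr2 => h; case: (j == i) => /=; lra.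
apply: (@le_trans _ _ (\sum_j (p j * (u ^+ 2 + n%:R + 1) + 2 * u * (p j * v j)))).
  apply: ler_sum => j _; have := ler_wpM2l (p_ge0 j) (v1 j); nra.
rewrite big_split/= -mulr_suml p_sum1 -mulr_sumr sv -natr1; lra.
Qed.

End WordExpectation.

Lemma wexp_map (R : realType) (I J : finType) (q : J -> R) (f : J -> I) n F :
  wexp q n (fun s => F (map f s)) =
  wexp (fun i => \sum_(j | f j == i) q j) n F.
Proof.
elim: n F => [|n IH] F //=.
rewrite (partition_big f xpredT)//=; apply: eq_bigr => i _.
rewrite mulr_suml; apply: eq_bigr => j /eqP <-.
by rewrite -IH.
Qed.

(** Greedy matching: [u] is the multiset intersection of [s] and [t], and the truncated differences
    count the letters of [s] left unmatched. *)
Lemma common_letters (I : finType) (s t : seq I) :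
  exists u s' t', [/\ perm_eq s (u ++ s'), perm_eq t (u ++ t')
    & size s' = \sum_i (count_mem i s - count_mem i t)]%N.
Proof.
elim: s t => [|a s IH] t.
  by exists [::], [::], t; split=> //; rewrite big1.
have [at_|at_] := boolP (a \in t).
  have [u [s' [t' [h1 h2 h3]]]] := IH (rem a t).
  exists (a :: u), s', t'; split => /=; first by rewrite perm_cons.
    by apply: perm_trans (perm_to_rem at_) _; rewrite perm_cons.
  rewrite h3; apply: eq_bigr => i _.
  by have /seq.permP -> := perm_to_rem at_; rewrite /=; case: (a == i).
have [u [s' [t' [h1 h2 h3]]]] := IH t.
exists u, (a :: s'), t'; split => //.
  by rewrite perm_sym -(cat1s a s') perm_catCA/= perm_cons perm_sym.
rewrite /= h3 (bigD1 a)//= [RHS](bigD1 a)//= eqxx add1n.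
have /count_memPn -> := at_; rewrite !subn0 addSn; congr (_ + _).+1.
by apply: eq_bigr => i /negbTE; rewrite eq_sym => ->.
Qed.

(** * Law of large numbers for the means of samples *)

Section FiniteBarycenter.
Variables (R : realType) (X : pointedType) (d : X -> X -> R).
Hypotheses (dm : is_metric d) (dc : is_complete d).
Variable sigma : X -> X -> R -> X.
Hypothesis cb : conical_bicombing d sigma.
Local Notation M := (seq_mean d sigma).

(** Convergence in mean of the sample means. Words are drawn among labels and only then placed by
    [x], so that two families of points can share the same sample. *)
Definition finite_bary (I : finType) (p : I -> R) (x : I -> X) z :=
  forall e : R, 0 < e -> exists N, forall n, (N <= n)%N ->
    wexp p n (fun s => d (M (map x s)) z) < e.

(** Merging labels leaves the law of the sampled points unchanged; two labellings can thus be
    compared on their joint refinement. *)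
Lemma finite_bary_map (I J : finType) (q : J -> R) (f : J -> I) x z :
  finite_bary (fun i => \sum_(j | f j == i) q j) x z <->
  finite_bary q (x \o f) z.
Proof.
have E n : wexp q n (fun s => d (M (map (x \o f) s)) z) =
    wexp (fun i => \sum_(j | f j == i) q j) n (fun s => d (M (map x s)) z).
  rewrite -wexp_map; congr wexp; apply/funext => s.
  by rewrite map_comp.
by split=> h e /h[N hN]; exists N => n /hN; rewrite E.
Qed.

Section FixedLaw.
Variables (I : finType) (p : I -> R).
Hypotheses (p_ge0 : forall i, 0 <= p i) (p_sum1 : \sum_i p i = 1).
Local Notation E := (wexp p).

Lemma finite_bary_const c : finite_bary p (fun=> c) c.
Proof.
move=> e e0; exists 1%N => -[//|n] _.
rewrite (@eq_wexp _ _ _ p_ge0 _ _ (fun=> 0)) ?wexp_cst// => s ss.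
suff -> : [seq c | _ <- s] = nseq n.+1 c by rewrite (seq_mean_const dm cb dc) (distxx dm).
by rewrite -ss; elim: (s) => //= a t ->.
Qed.

Lemma wexp_mean_lipschitz n x y :
  E n.+1 (fun s => d (M (map x s)) (M (map y s))) <= \sum_i p i * d (x i) (y i).
Proof.
have n0 : 0 < n.+1%:R :> R by rewrite ltr0n.
rewrite -(ler_pM2l n0) -(wexp_additive p_ge0 p_sum1 _ (fun i => _ (x i) _)) -[leLHS]addr0 -(wexp_affine p_sum1).
apply: wexp_le => // s ss; rewrite addr0.
apply: le_trans (seq_mean_lipschitz dm cb dc _ _) _; rewrite ?size_map//.
case: s ss => // a s ss; rewrite (big_nth a) big_mkord ss.
by apply: ler_sum => i _; rewrite !(nth_map a) ?ss.
Qed.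

Lemma finite_bary_lipschitz x y z w :
  finite_bary p x z -> finite_bary p y w ->
  d z w <= \sum_i p i * d (x i) (y i).
Proof.
move=> hz hw; apply/ler_addgt0Pr => e e0.
have [N hN] := hz _ (divr_gt0 e0 (ltr0n R 2)).
have [N' hN'] := hw _ (divr_gt0 e0 (ltr0n R 2)).
pose n := (maxn N N').+1.
have := hN n (leqW (leq_maxl _ _)); have := hN' n (leqW (leq_maxr _ _)).
have := wexp_mean_lipschitz (maxn N N') x y; rewrite -/n => h1 h2 h3.
have : d z w <= E n (fun s => d (M (map x s)) z +
    (d (M (map x s)) (M (map y s)) + d (M (map y s)) w)).
  rewrite -[leLHS](wexp_cst p_sum1 n); apply: wexp_le => // s _.
  rewrite (distC dm _ z); apply: le_trans (dist_triangle dm (M (map x s)) _ _) _.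
  by rewrite lerD2l; exact: dist_triangle.
rewrite !wexpD; lra.
Qed.

Variable x : I -> X.
Local Notation D n := (E n (fun t => E n (fun s => d (M (map x s)) (M (map x t))))).

(** After reordering, the common letters of [s] and [t] occupy the same positions; only the
    unmatched ones contribute, each at most [r], and the count differences bound their number. *)
Lemma mean_count_dist n r s t : size s = n.+1 -> size t = n.+1 ->
  (forall i j, d (x i) (x j) <= r) ->
  n.+1%:R * d (M (map x s)) (M (map x t)) <=
    r * \sum_i `|(count_mem i s)%:R - (count_mem i t)%:R|.
Proof.
move=> ss st hr; have [u [s' [t' [hs ht hs']]]] := common_letters s t.
have sz' : size (u ++ s') = n.+1 by rewrite -(perm_size hs).
have tz' : size (u ++ t') = n.+1 by rewrite -(perm_size ht).
have -> : M (map x s) = M (map x (u ++ s')).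
  by apply: (seq_mean_perm dm cb dc); rewrite ?size_map ?ss// perm_map.
have -> : M (map x t) = M (map x (u ++ t')).
  by apply: (seq_mean_perm dm cb dc); rewrite ?size_map ?st// perm_map.
apply: le_trans (seq_mean_lipschitz dm cb dc _ _) _; rewrite ?size_map//.
have [a r0] : exists a : I, 0 <= r.
  case: (s) ss => // a _ _; exists a.
  by apply: le_trans (hr a a); rewrite (distxx dm).
apply: (@le_trans _ _ (\sum_(i < n.+1) if (size u <= i)%N then r else 0)).
  apply: ler_sum => i _; rewrite !(nth_map a) ?sz' ?tz'// !nth_cat.
  by case: leqP => // _; rewrite (distxx dm).
rewrite -big_mkcond/=.
have -> : \sum_(i < n.+1 | (size u <= i)%N) r = r * (size s')%:R.
  rewrite -(big_geq_mkord (size u) n.+1 xpredT (fun=> r)) sumr_const_nat.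
  by rewrite -sz' size_cat addKn mulr_natr.
apply: ler_wpM2l => //; rewrite hs' natr_sum; apply: ler_sum => i _.
have [h|h] := leqP (count_mem i t) (count_mem i s).
  by rewrite natrB// ler_norm.
by move: (ltnW h); rewrite -subn_eq0 => /eqP ->; rewrite normr_ge0.
Qed.

(** Centred letter counts have second moment at most [n] by [wexp_count_sqr], so the counts of two
    independent samples differ by [O(sqrt n)] on average; the division by [n] in [mean_count_dist]
    sends the spread to 0. *)
Lemma mean_spread e : 0 < e -> exists N, forall n, (N <= n)%N -> D n < e.
Proof.
move=> e0; pose r := \sum_i \sum_j d (x i) (x j).
have hr i j : d (x i) (x j) <= r.
  rewrite /r (bigD1 i)//= (bigD1 j)//= -addrA lerDl addr_ge0//.
    by apply: sumr_ge0 => *; exact: dist_ge0.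
  by do 2![apply: sumr_ge0 => *]; exact: dist_ge0.
have r0 : 0 <= r by apply: sumr_ge0 => i _; apply: sumr_ge0 => j _; exact: dist_ge0.
pose k : R := #|I|%:R; have k0 : 0 <= k by rewrite ler0n.
(* The summand 1 keeps [C] positive when [r * k = 0]; [ep] makes [C * ep] equal to [e / 4]. *)
pose C := r * k + 1; have C0 : 0 < C by rewrite ltr_wpDl// mulr_ge0.
pose ep := e / (4 * C); have ep0 : 0 < ep by rewrite divr_gt0// mulr_gt0.
have bound n : D n.+1 <= r * k * ((ep * n.+1%:R)^-1 + ep).
  have n0 : 0 < n.+1%:R :> R by rewrite ltr0n.
  (* Proportional to [n.+1]: cruder than the optimal order [sqrt n], but the bound stays free of
     square roots. *)
  pose de := ep * n.+1%:R; have de0 : 0 < de by rewrite mulr_gt0.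
  pose g s : R := \sum_i (0 + (count_mem i s)%:R - n.+1%:R * p i) ^+ 2.
  have Eg : E n.+1 g <= k * n.+1%:R.
    rewrite wexp_sum; apply: (@le_trans _ _ (\sum_(i : I) n.+1%:R)).
      apply: ler_sum => i _; have := wexp_count_sqr p_ge0 p_sum1 n.+1 i 0.
      by rewrite expr0n add0r.
    by rewrite sumr_const mulr_natl.
  have pt s t : size s = n.+1 -> size t = n.+1 ->
      d (M (map x s)) (M (map x t)) <=
      r / n.+1%:R * ((2 * de)^-1 * g s + ((2 * de)^-1 * g t + k * de)).
    move=> ss st; rewrite -(ler_pM2l n0) mulrA [_ * (r / _)]mulrC divfK ?gt_eqF//.
    apply: le_trans (mean_count_dist ss st hr) _; apply: ler_wpM2l => //.
    rewrite /g !mulr_sumr /k -sum1_card natr_sum mulr_suml -!big_split/=.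
    apply: ler_sum => i _; rewrite mul1r !add0r.
    (* AM-GM: [|a - b| <= (a^2 + b^2) / (2 de) + de] *)
    set a := _ - n.+1%:R * p i; set b := (count_mem i t)%:R - n.+1%:R * p i.
    have -> : (count_mem i s)%:R - (count_mem i t)%:R = a - b by rewrite /a /b; ring.
    have amgm (c : R) : `|c| <= (2 * de)^-1 * c ^+ 2 + de / 2.
      have d2 : 0 < 2 * de by rewrite mulr_gt0.
      rewrite -(ler_pM2l d2) mulrDr mulVKf ?gt_eqF// -(real_normK (num_real c)).
      by have := sqr_ge0 (`|c| - de); nra.
    have := ler_normB a b; have := amgm a; have := amgm b; lra.
  have inner t : size t = n.+1 -> E n.+1 (fun s => d (M (map x s)) (M (map x t))) <=
      r / n.+1%:R * ((2 * de)^-1 * E n.+1 g + ((2 * de)^-1 * g t + k * de)).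
    move=> st; rewrite -(wexp_affine p_sum1) -[leRHS]addr0 -(wexp_affine p_sum1).
    by apply: wexp_le => // s ss; rewrite addr0; exact: pt.
  apply: (@le_trans _ _ (r / n.+1%:R *
      ((2 * de)^-1 * E n.+1 g + ((2 * de)^-1 * E n.+1 g + k * de)))).
    rewrite addrCA -(wexp_affine p_sum1) -[leRHS]addr0 -(wexp_affine p_sum1).
    by apply: wexp_le => // t st; rewrite addr0 addrCA; exact: inner.
  apply: (@le_trans _ _ (r / n.+1%:R * (de^-1 * (k * n.+1%:R) + k * de))).
    apply: ler_wpM2l; first by rewrite divr_ge0// ltW.
    rewrite addrA lerD2r; set G := E _ g in Eg *.
    have -> : (2 * de)^-1 * G + (2 * de)^-1 * G = de^-1 * G.
      by field; rewrite gt_eqF.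
    by rewrite ler_wpM2l// invr_ge0 ltW.
  rewrite le_eqVlt; apply/orP; left; apply/eqP; rewrite /de; field.
  by rewrite !gt_eqF.
have Ce : C * ep = e / 4 by rewrite /ep; field; rewrite gt_eqF.
clearbody ep.
(* This threshold brings the other term, [C / (ep * n.+1)], to at most [e / 4]; the successor
   excludes empty words. *)
exists (Num.bound (4 * C / (e * ep))).+1 => -[//|n]; rewrite ltnS => hn.
apply: le_lt_trans (bound n) _.
have n0 : 0 < n.+1%:R :> R by rewrite ltr0n.
have hn' : 4 * C / (e * ep) < n.+1%:R.
  apply: lt_le_trans (archi_boundP _) _; last by rewrite ler_nat; exact: leqW hn.
  by apply/ltW/divr_gt0; rewrite mulr_gt0.
have h1 : C * (ep * n.+1%:R)^-1 <= e / 4.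
  rewrite ler_pdivrMr ?mulr_gt0//.
  move: hn'; rewrite ltr_pdivrMr ?mulr_gt0// => h.
  by move: (n.+1%:R) h => m h; nra.
have h2 : 0 <= (ep * n.+1%:R)^-1 by rewrite invr_ge0; apply/ltW/mulr_gt0.
have rk : r * k <= C by rewrite /C lerDl.
have := ler_wpM2r (addr_ge0 h2 (ltW ep0)) rk; rewrite [C * (_ + _)]mulrDr Ce.
move: (r * k * _) h1 => u; move: (C * _) => v; lra.
Qed.

(** This is [seq_mean_mono] averaged over words: by [wexp_remat] each deletion leaves a sample with
    one letter less, so all terms on the right have the same expectation. *)
Lemma wexp_mean_mono z m n : (2 <= m)%N -> (m <= n)%N ->
  E n (fun s => d (M (map x s)) z) <= E m (fun s => d (M (map x s)) z).
Proof.
move=> m2 /subnK <-; elim: (n - m)%N => //= k; apply: le_trans.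
have [q ->] : exists q, (k + m)%N = q.+2.
  by exists (k + m - 2)%N; rewrite -addn2 subnK// (leq_trans m2)// leq_addl.
change (E q.+3 (fun s => d (M (map x s)) z) <= E q.+2 (fun s => d (M (map x s)) z)).
have n0 : 0 < q.+3%:R :> R by rewrite ltr0n.
rewrite -(ler_pM2l n0) -[leLHS]addr0 -(wexp_affine p_sum1).
apply: (@le_trans _ _ (E q.+3 (fun s => \sum_(i < q.+3) d (M (map x (remat i s))) z))).
  apply: wexp_le => // s ss; rewrite addr0.
  apply: le_trans (seq_mean_mono dm cb dc _ _) _; first by rewrite size_map ss.
  by apply: ler_sum => i _; rewrite /remat map_cat map_take map_drop.
rewrite wexp_sum (eq_bigr (fun=> E q.+2 (fun s => d (M (map x s)) z))).
  by rewrite sumr_const card_ord mulr_natl.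
move=> i _; apply: (wexp_remat p_sum1 (fun s => d (M (map x s)) z)).
by rewrite -ltnS.
Qed.

(** [z n] is a sample mean whose mean distance to another sample mean is at most the average [D n].
    By monotonicity longer samples stay as close in mean to [z m], and two points close in mean to
    one random point are close to each other, so [z] is Cauchy. *)
Lemma finite_bary_exists : exists z, finite_bary p x z.
Proof.
have ex n : exists z, E n (fun s => d (M (map x s)) z) <= D n.
  have [t _ ht] := wexp_le_exists p_ge0 p_sum1 (lexx (D n)).
  by exists (M (map x t)).
have [z hz] := choice ex.
have small e : 0 < e -> exists N, forall m n, (N <= m)%N -> (m <= n)%N ->
    E n (fun s => d (M (map x s)) (z m)) < e.
  move=> /mean_spread[N hN]; exists (maxn N 2) => m n.
  rewrite geq_max => /andP[Nm m2] mn; apply: le_lt_trans (hN _ Nm).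
  exact: le_trans (wexp_mean_mono _ m2 mn) (hz m).
have tri n u v : d u v <= E n (fun s => d (M (map x s)) u) + E n (fun s => d (M (map x s)) v).
  rewrite -wexpD -[leLHS](wexp_cst p_sum1 n); apply: wexp_le => // s _.
  by rewrite (distC dm _ u); exact: dist_triangle.
have [|l hl] := @dc z.
  move=> e e0; have [N hN] := small _ (divr_gt0 e0 (ltr0n R 2)).
  exists N => m n Nm Nn; apply: le_lt_trans (tri (maxn m n) _ _) _.
  have := hN _ _ Nm (leq_maxl m n); have := hN _ _ Nn (leq_maxr m n); lra.
exists l => e e0; have [N hN] := small _ (divr_gt0 e0 (ltr0n R 2)).
have [N' hN'] := hl _ (divr_gt0 e0 (ltr0n R 2)).
pose m := maxn N N'; exists m => n mn.
apply: (@le_lt_trans _ _ (1 * E n (fun s => d (M (map x s)) (z m)) + d (z m) l)).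
  rewrite -(wexp_affine p_sum1); apply: wexp_le => // s _; rewrite mul1r.
  exact: dist_triangle.
have := hN _ _ (leq_maxl N N') mn; have := hN' _ (leq_maxr N N'); rewrite -/m; lra.
Qed.

End FixedLaw.
End FiniteBarycenter.

(** * Borel measures on a metric space *)

Section Labels.
Variables (dsp : measure_display) (T : measurableType dsp) (R : realType).

Definition measurable_label (I : finType) (k : T -> I) :=
  forall i, measurable (k @^-1` [set i]).

Lemma label_pair (I J : finType) (k : T -> I) (l : T -> J) :
  measurable_label k -> measurable_label l -> measurable_label (fun t => (k t, l t)).
Proof.
move=> mk ml [i j].
have -> : (fun t => (k t, l t)) @^-1` [set (i, j)] =
    (k @^-1` [set i]) `&` (l @^-1` [set j]).
  by apply/seteqP; split => [t /= [-> ->]|t /= [-> ->]].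
exact: measurableI.
Qed.

Lemma measurable_fun_label (dsp' : measure_display) (Y : measurableType dsp')
    (I : finType) (k : T -> I) (f : I -> T -> Y) :
  measurable_label k -> (forall i, measurable_fun setT (f i)) ->
  measurable_fun setT (fun t => f (k t) t).
Proof.
move=> mk mf _ B mB; rewrite setTI.
have -> : (fun t => f (k t) t) @^-1` B =
    \bigcup_(i in [set: I]) ((k @^-1` [set i]) `&` (f i @^-1` B)).
  apply/seteqP; split => [t ft|t [i _ [/= <-]]//].
  by exists (k t).
apply: fin_bigcup_measurable; first exact: finite_finset.
by move=> i _; apply: measurableI => //; rewrite -[X in measurable X]setTI; exact: mf.
Qed.

Variable P : {measure set T -> \bar R}.

Definition label_law (I : finType) (k : T -> I) (i : I) : R :=
  fine (P (k @^-1` [set i])).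

Lemma label_law_ge0 (I : finType) (k : T -> I) i : 0 <= label_law k i.
Proof. exact: fine_ge0. Qed.

Hypothesis PT : P setT = 1%E.

Lemma label_lawE (I : finType) (k : T -> I) i : measurable_label k ->
  P (k @^-1` [set i]) = (label_law k i)%:E.
Proof.
move=> mk; rewrite fineK// ge0_fin_numE//.
by apply: (@le_lt_trans _ _ (P setT)); [apply: le_measure; rewrite ?inE|rewrite PT ltry].
Qed.

Lemma integral_label (I : finType) (k : T -> I) (g : I -> R) :
  measurable_label k -> (forall i, 0 <= g i) ->
  (\int[P]_t (g (k t))%:E = (\sum_i label_law k i * g i)%:E)%E.
Proof.
move=> mk g0.
have mi i : measurable_fun [set: T] (EFin \o (\1_(k @^-1` [set i]) : T -> R)).
  by apply/measurable_EFinP; exact: measurable_indic.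
transitivity (\int[P]_t (\sum_(i <- index_enum I)
    ((g i)%:E * (\1_(k @^-1` [set i]) t)%:E)))%E.
  apply: eq_integral => t _; rewrite (bigD1 (k t))//= indicE mem_set// mule1.
  rewrite big1 ?adde0// => i ik; rewrite indicE memNset ?mule0//=.
  by move=> ki; rewrite ki eqxx in ik.
rewrite ge0_integral_sum//; last 2 first.
- by move=> i; apply: measurable_funeM; exact: mi.
- by move=> i t _; rewrite -EFinM lee_fin mulr_ge0// indicE ler0n.
rewrite -sumEFin; apply: eq_bigr => i _.
rewrite ge0_integralZl_EFin//; last exact: mi.
by rewrite integral_indic// setIT label_lawE// muleC -EFinM.
Qed.

Lemma label_law_sum (I : finType) (k : T -> I) : measurable_label k ->
  \sum_i label_law k i = 1.
Proof.
move=> mk; apply: EFin_inj.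
rewrite (eq_bigr (fun i => label_law k i * 1)); last by move=> i _; rewrite mulr1.
rewrite -(integral_label mk (fun=> ler01)) integral_cst// PT mul1e.
exact: erefl.
Qed.

Lemma label_law_comp (I J : finType) (k : T -> J) (f : J -> I) :
  measurable_label k -> measurable_label (f \o k) ->
  (fun i => \sum_(j | f j == i) label_law k j) = label_law (f \o k).
Proof.
move=> mk mfk; apply/funext => i; apply: EFin_inj.
have := @integral_label _ (f \o k) (fun j => (j == i)%:R) mfk.
have := @integral_label _ k (fun j => (f j == i)%:R) mk.
move=> /(_ (fun _ => ler0n _ _)) h /(_ (fun _ => ler0n _ _)); rewrite [LHS]h.
have -> : \sum_j label_law k j * (f j == i)%:R = \sum_(j | f j == i) label_law k j.
  by rewrite [RHS]big_mkcond; apply: eq_bigr => j _; case: eqP => _; rewrite ?mulr1 ?mulr0.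
move=> ->; rewrite (bigD1 i)//= eqxx mulr1 big1 ?addr0// => j /negbTE ->.
by rewrite mulr0.
Qed.

End Labels.

(** * Measurability of distances, projections and compact sets *)

Section BorelDistance.
Variables (R : realType) (X : pointedType) (d : X -> X -> R).
Hypothesis dm : is_metric d.

Lemma mopen_measurable (Y : pointedType) (e : Y -> Y -> R) U :
  mopen e U -> measurable (U : set (borel e)).
Proof. exact: sub_sigma_algebra. Qed.

Lemma measurable_fun_sublevel (dsp : measure_display) (T : measurableType dsp) (f : T -> R) :
  (forall r, measurable [set t | f t < r]) -> measurable_fun setT f.
Proof.
move=> h; apply: (measurability _ (RGenInftyO.measurableE R)).
move=> _ [_ [r ->] <-]; rewrite setTI.
suff -> : f @^-1` `]-oo, r[%classic = [set t | f t < r] by exact: h.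
by apply/seteqP; split => t; rewrite /= in_itv /=.
Qed.

Lemma mopen_ball x r : mopen d [set y | d x y < r].
Proof.
move=> y /= xy; exists (r - d x y); first by rewrite subr_gt0.
move=> z /=; have := dist_triangle dm y x z; lra.
Qed.

Lemma measurable_mball x r : measurable ([set y | d x y < r] : set (borel d)).
Proof. exact: mopen_measurable (@mopen_ball x r). Qed.

Lemma measurable_dist x : measurable_fun setT (d x : borel d -> R).
Proof. by apply: measurable_fun_sublevel => r; exact: measurable_mball. Qed.

(** The Borel sigma-algebra of [dprod d] may exceed the product one, but openness suffices: the
    distance is 1-Lipschitz for [dprod d]. *)
Lemma measurable_dist2 :
  measurable_fun setT ((fun p => d p.1 p.2) : borel (dprod d) -> R).
Proof.
apply: measurable_fun_sublevel => r; apply: mopen_measurable => p /= pr.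
exists (r - d p.1 p.2); first by rewrite subr_gt0.
move=> q; rewrite /dprod /=.
have := dist_triangle dm p.1 q.1 q.2; have := dist_triangle dm p.2 p.1 q.2.
rewrite (distC dm q.1 p.1); lra.
Qed.

Lemma measurable_fun_borel (Y Z : pointedType) (e : Y -> Y -> R) (e' : Z -> Z -> R)
    (f : borel e -> borel e') :
  (forall U, mopen e' U -> mopen e (f @^-1` U)) -> measurable_fun setT f.
Proof.
move=> h; apply: (@measurability _ _ (borel e) (borel e') setT f (mopen e')) => //.
by move=> _ [U oU <-]; rewrite setTI; apply: mopen_measurable; exact: h.
Qed.

Lemma measurable_dprod_fst : measurable_fun setT (fst : borel (dprod d) -> borel d).
Proof.
apply: measurable_fun_borel => U oU p /oU[r r0 h]; exists r => // q /= pq.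
by apply: h; apply: le_lt_trans pq; rewrite /dprod lerDl (dist_ge0 dm).
Qed.

Lemma measurable_dprod_snd : measurable_fun setT (snd : borel (dprod d) -> borel d).
Proof.
apply: measurable_fun_borel => U oU p /oU[r r0 h]; exists r => // q /= pq.
by apply: h; apply: le_lt_trans pq; rewrite /dprod lerDr (dist_ge0 dm).
Qed.

(** Compact sets are closed: for [x] outside [K], the complements of the closed balls of radius
    [1 / n.+1] at [x] cover [K], and a finite subcover leaves a ball at [x] that misses [K]. *)
Lemma mcompact_measurable K : mcompact d K -> measurable (K : set (borel d)).
Proof.
move=> cK; rewrite -[K]setCK; apply: measurableC; apply: mopen_measurable => x /= Kx.
have [n y /=|y Ky|F finF KF] := cK nat (fun n => [set y | n.+1%:R^-1 < d x y]).
- set c := n.+1%:R^-1 => xy; exists (d x y - c); first by rewrite subr_gt0.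
  move=> z /=; move: c xy => c xy; have := dist_triangle dm z x y; rewrite (distC dm z y); lra.
- have dxy : 0 < d x y.
    rewrite lt_neqAle (dist_ge0 dm) andbT eq_sym; apply/eqP => /(dist_eq0 dm) xy.
    by apply: Kx; rewrite xy.
  have xy0 : 0 <= (d x y)^-1 by rewrite invr_ge0 ltW.
  exists (Num.bound (d x y)^-1) => //=.
  rewrite invf_plt ?posrE//; apply: lt_le_trans (archi_boundP xy0) _.
  by rewrite ler_nat.
- have [s sF] := (finite_seqP _).1 finF.
  (* Least radius in the subcover; the start value 1 handles an empty one. *)
  exists (\big[Order.min/1]_(n <- s) n.+1%:R^-1).
    apply: (big_ind (fun a : R => 0 < a)) => // a b a0 b0.
    by rewrite lt_min a0.
  move=> y /= xy Ky; have [n Fn /= h] := KF _ Ky.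
  have ns : n \in s by move: Fn; rewrite sF.
  have : d x y < n.+1%:R^-1.
    by apply: lt_le_trans xy _; exact: (@ge_bigmin_seq _ R _ s 1 n xpredT (fun n => n.+1%:R^-1)) ns isT.
  by move/(lt_trans h); rewrite ltxx.
Qed.

End BorelDistance.

(** * Barycenters of Radon measures *)

Section MeasureBarycenter.
Variables (R : realType) (X : pointedType) (d : X -> X -> R).
Hypotheses (dm : is_metric d) (dc : is_complete d).
Variable sigma : X -> X -> R -> X.
Hypothesis cb : conical_bicombing d sigma.
Local Notation fbary := (finite_bary d sigma).

(** Both points are barycenters for the joint label [(k, l)], whose law couples those of [k] and
    [l]. *)
Lemma finite_bary_label_lipschitz (dsp : measure_display)
    (T : measurableType dsp) (P : {measure set T -> \bar R}) (I J : finType)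
    (k : T -> I) (l : T -> J) (x : I -> X) (y : J -> X) z w :
  P setT = 1%E -> measurable_label k -> measurable_label l ->
  fbary (label_law P k) x z -> fbary (label_law P l) y w ->
  ((d z w)%:E <= \int[P]_t (d (x (k t)) (y (l t)))%:E)%E.
Proof.
move=> PT mk ml hz hw; pose kl t := (k t, l t).
have mkl : measurable_label kl by exact: label_pair.
have hz' : fbary (label_law P kl) (x \o fst) z.
  by apply/finite_bary_map; rewrite (label_law_comp PT).
have hw' : fbary (label_law P kl) (y \o snd) w.
  by apply/finite_bary_map; rewrite (label_law_comp PT).
rewrite (integral_label PT (g := fun ij => d (x ij.1) (y ij.2)) mkl); last first.
  by move=> ij; exact: dist_ge0.
rewrite lee_fin; apply: (finite_bary_lipschitz dm dc cb _ _ hz' hw').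
- exact: label_law_ge0.
- exact: label_law_sum.
Qed.

(** [x \o k] is a finitely valued map at mean distance at most [e] from the identity, and [z] is the
    barycenter of its law. *)
Definition approx_bary (mu : {measure set (borel d) -> \bar R}) e z :=
  exists n (k : borel d -> 'I_n) (x : 'I_n -> X),
    [/\ measurable_label k, fbary (label_law mu k) x z
      & (\int[mu]_t (d t (x (k t)))%:E <= e%:E)%E].

Definition is_bary (mu : {measure set (borel d) -> \bar R}) z :=
  forall e, 0 < e -> exists2 z', approx_bary mu e z' & d z z' <= e.

Lemma measurable_dist_label (I : finType) (k : borel d -> I) (x : I -> X) :
  measurable_label k -> measurable_fun [set: borel d] (fun t => (d t (x (k t)))%:E).
Proof.
move=> mk; apply/measurable_EFinP.
apply: (@measurable_fun_label _ (borel d) _ _ I k (fun i t => d t (x i))) => // i.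
rewrite (_ : (fun t => d t (x i)) = d (x i)); first exact: measurable_dist.
by apply/funext => t; rewrite (distC dm).
Qed.

Lemma integral_coupling (g : {measure set (borel (dprod d)) -> \bar R})
    (mu : {measure set (borel d) -> \bar R}) (pr : borel (dprod d) -> borel d)
    (f : borel d -> \bar R) :
  measurable_fun setT pr ->
  (forall A : set (borel d), measurable A -> g (pr @^-1` A) = mu A) ->
  measurable_fun setT f -> (forall t, 0 <= f t)%E ->
  (\int[g]_p f (pr p) = \int[mu]_t f t)%E.
Proof.
move=> mpr gmu mf f0.
have := @ge0_integral_pushforward _ _ _ _ R pr mpr g setT f measurableT mf
  (fun t _ => f0 t).
rewrite preimage_setT => <-; apply: eq_measure_integral => A mA _.
exact: gmu.
Qed.

(** Composed with the projections, both labels live on the space of [g]; the triangle inequality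
    through [p.1] and [p.2] then leaves two error terms that depend on one marginal each. *)
Lemma approx_bary_coupling mu nu g e e' z w :
  coupling mu nu g -> approx_bary mu e z -> approx_bary nu e' w ->
  ((d z w)%:E <= \int[g]_p (d p.1 p.2)%:E + (e + e')%:E)%E.
Proof.
move=> [[gT _] [g1 g2]] [n [k [x [mk hz he]]]] [m [l [y [ml hw he']]]].
have mfst := measurable_dprod_fst dm; have msnd := measurable_dprod_snd dm.
have law1 : label_law g (k \o fst) = label_law mu k.
  by apply/funext => i; rewrite /label_law comp_preimage g1.
have law2 : label_law g (l \o snd) = label_law nu l.
  by apply/funext => i; rewrite /label_law comp_preimage g2.
have mk1 : measurable_label (k \o (fst : borel (dprod d) -> borel d)).
  by move=> i; rewrite comp_preimage -[X in measurable X]setTI; exact: mfst.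
have ml2 : measurable_label (l \o (snd : borel (dprod d) -> borel d)).
  by move=> i; rewrite comp_preimage -[X in measurable X]setTI; exact: msnd.
rewrite -law1 in hz; rewrite -law2 in hw.
apply: le_trans (finite_bary_label_lipschitz gT mk1 ml2 hz hw) _.
have mx := measurable_dist_label x mk; have my := measurable_dist_label y ml.
have md : measurable_fun [set: borel (dprod d)] (fun p => (d p.1 p.2)%:E).
  by apply/measurable_EFinP; exact: measurable_dist2.
have mx1 : measurable_fun [set: borel (dprod d)] (fun p => (d p.1 (x (k p.1)))%:E).
  exact: (measurableT_comp mx mfst).
have my2 : measurable_fun [set: borel (dprod d)] (fun p => (d p.2 (y (l p.2)))%:E).
  exact: (measurableT_comp my msnd).
have ge0 (h : borel (dprod d) -> R) : (forall p, 0 <= h p) ->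
    forall p, setT p -> (0 <= (h p)%:E)%E by move=> h0 p _; rewrite lee_fin.
apply: (@le_trans _ _ (\int[g]_p ((d p.1 p.2)%:E +
    ((d p.1 (x (k p.1)))%:E + (d p.2 (y (l p.2)))%:E)))%E).
  apply: ge0_le_integral => //.
  - by move=> p _; rewrite lee_fin dist_ge0.
  - apply/measurable_EFinP.
    apply: (@measurable_fun_label _ _ _ _ _ _ (fun ij _ => d (x ij.1) (y ij.2))
      (label_pair mk1 ml2)) => ij; exact: measurable_cst.
  - by apply: emeasurable_funD => //; exact: emeasurable_funD.
  - move=> p _; rewrite -!EFinD lee_fin.
    have := dist_triangle dm p.1 (x (k p.1)) (y (l p.2)).
    have := dist_triangle dm p.2 p.1 (y (l p.2)).
    rewrite (distC dm (x _) p.1) /=; lra.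
rewrite ge0_integralD//; first last.
- exact: emeasurable_funD.
- by move=> p _; rewrite -EFinD lee_fin addr_ge0// dist_ge0.
- by move=> p _; rewrite lee_fin dist_ge0.
rewrite leeD2l// ge0_integralD//; first last.
- by move=> p _; rewrite lee_fin dist_ge0.
- by move=> p _; rewrite lee_fin dist_ge0.
rewrite EFinD; apply: leeD.
- rewrite (@integral_coupling g mu fst (fun t => (d t (x (k t)))%:E))// => t.
  by rewrite lee_fin dist_ge0.
- rewrite (@integral_coupling g nu snd (fun t => (d t (y (l t)))%:E))// => t.
  by rewrite lee_fin dist_ge0.
Qed.

(** The argument of [approx_bary_coupling] along the diagonal, carried out directly on [mu]. *)
Lemma approx_bary_dist (mu : {measure set (borel d) -> \bar R}) e e' z w :
  mu setT = 1%E -> approx_bary mu e z -> approx_bary mu e' w -> d z w <= e + e'.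
Proof.
move=> muT [n [k [x [mk hz he]]]] [m [l [y [ml hw he']]]].
rewrite -lee_fin; apply: le_trans (finite_bary_label_lipschitz muT mk ml hz hw) _.
have mx := measurable_dist_label x mk; have my := measurable_dist_label y ml.
apply: (@le_trans _ _ (\int[mu]_t ((d t (x (k t)))%:E + (d t (y (l t)))%:E))%E).
  apply: ge0_le_integral => //.
  - by move=> t _; rewrite lee_fin dist_ge0.
  - apply/measurable_EFinP.
    apply: (@measurable_fun_label _ _ _ _ _ _ (fun ij _ => d (x ij.1) (y ij.2))
      (label_pair mk ml)) => ij; exact: measurable_cst.
  - exact: emeasurable_funD.
  - move=> t _; rewrite -!EFinD lee_fin (distC dm t (x _)).
    exact: dist_triangle.
rewrite ge0_integralD//; first last.
- by move=> p _; rewrite lee_fin dist_ge0.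
- by move=> p _; rewrite lee_fin dist_ge0.
by rewrite EFinD; apply: leeD.
Qed.

Lemma is_bary_dirac x z : is_bary (\d_(x : borel d)) z -> z = x.
Proof.
move=> hz; apply: (dist_eq0 dm); apply/eqP; rewrite eq_le (dist_ge0 dm) andbT.
apply/ler_addgt0Pr => e e0; rewrite add0r.
have dT : (\d_(x : borel d) setT = 1 :> \bar R)%E by exact: diracT.
have [z' hz' zz'] := hz _ (divr_gt0 e0 (ltr0n R 2)).
(* Under the point mass at [x] the constant map to [x] is at mean distance 0 from the identity. *)
have hx : approx_bary (\d_(x : borel d)) 0 x.
  have mk : measurable_label ((fun=> ord0) : borel d -> 'I_1).
    move=> i; rewrite (_ : _ @^-1` _ = setT)//.
    by apply/seteqP; split => // t _ /=; rewrite [i]ord1.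
  exists 1%N, (fun=> ord0), (fun=> x); split => //.
  - apply: (finite_bary_const dm dc cb) => [i|]; first exact: label_law_ge0.
    exact: label_law_sum.
  - rewrite integral_dirac// ?diracT ?mul1e ?(distxx dm)//.
    apply/measurable_EFinP; rewrite (_ : (fun t => d t x) = d x).
      exact: measurable_dist.
    by apply/funext => t; rewrite (distC dm).
have := approx_bary_dist dT hz' hx.
have := dist_triangle dm z' z x; lra.
Qed.

Lemma is_bary_lipschitz mu nu z w :
  is_bary mu z -> is_bary nu w -> ((d z w)%:E <= W1 mu nu)%E.
Proof.
move=> hz hw; apply/ereal_infP => _ [g cg <-].
apply/lee_addgt0Pr => e e0; have e4 : 0 < e / 4 by rewrite divr_gt0.
have [z' hz' zz'] := hz _ e4; have [w' hw' ww'] := hw _ e4.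
have := approx_bary_coupling cg hz' hw'.
have : ((d z w)%:E <= (d z' w')%:E + (e / 4 + e / 4)%:E)%E.
  rewrite -EFinD lee_fin.
  have := dist_triangle dm z' z w; have := dist_triangle dm w' z' w.
  rewrite (distC dm w' w); lra.
move=> /le_trans h1 h2; apply: h1.
apply: le_trans (leeD2r _ h2) _; rewrite -addeA -EFinD.
by rewrite leeD2l// lee_fin; lra.
Qed.

(* The index of the first ball of radius [r] around a point of [s] that
   contains [t] ([size s] when there is none). *)
Definition first_ball (r : R) (s : seq X) (t : borel d) := find (fun y => d y t < r) s.

Lemma measurable_first_ball r s i :
  measurable (first_ball r s @^-1` [set i] : set (borel d)).
Proof.
elim: s i => [|y s IH] i.
  case: i => [|i].
    by rewrite (_ : _ @^-1` _ = setT)//; apply/seteqP; split.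
  by rewrite (_ : _ @^-1` _ = set0)//; apply/seteqP; split.
have mb := measurable_mball dm y r; case: i => [|i].
  rewrite (_ : _ @^-1` _ = [set t | d y t < r])//.
  by apply/seteqP; split => t; rewrite /first_ball/=; case: ifP.
rewrite (_ : _ @^-1` _ = (~` [set t | d y t < r]) `&` (first_ball r s @^-1` [set i])).
  by apply: measurableI => //; exact: measurableC.
apply/seteqP; split => t; rewrite /first_ball/=; case: (d y t < r) => //=.
- by case.
- by case.
- by case=> _ ->.
Qed.

(** A compact [K] carries so much mass that the integral of [d x0] off [K] is below [e / 2].
    Finitely many balls of radius [e / 2] cover [K]; each point goes to the centre of the first one
    containing it, and to [x0] if there is none. *)
Lemma P1_approx_bary mu (e : R) : P1 mu -> 0 < e -> exists z, approx_bary mu e z.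
Proof.
move=> [[muT muK] [x0 fin]] e0; have e2 : 0 < e / 2 by rewrite divr_gt0.
have mf := measurable_dist dm x0.
have intf : mu.-integrable setT (EFin \o (d x0 : borel d -> R)).
  apply/integrableP; split; first exact/measurable_EFinP.
  apply: le_lt_trans fin; rewrite le_eqVlt; apply/orP; left; apply/eqP.
  by apply: eq_integral => t _ /=; rewrite ger0_norm// dist_ge0.
have [de [de0 hde]] := integral_normr_continuous intf e2.
have [K [cK _] hK] : exists2 K : set X, mcompact d K /\ K `<=` setT &
    (1 - de%:E < mu K)%E.
  have : (1 - de%:E < mu setT)%E by rewrite muT -EFinB lte_fin ltrBlDr ltrDl.
  rewrite (muK _ measurableT) => /ereal_sup_gt[_ [K [cK KT] <-] h].
  by exists K.
have mK := mcompact_measurable dm cK.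
have muKC : (mu (~` K) < de%:E)%E.
  have muKfin : mu K \is a fin_num.
    rewrite ge0_fin_numE//; apply: (@le_lt_trans _ _ (mu setT)).
      by apply: le_measure; rewrite ?inE.
    by rewrite muT ltry.
  have -> : (mu (~` K) = 1 - mu K)%E.
    have fT : (mu setT < +oo)%E by rewrite muT ltry.
    rewrite -setTD measureD//.
    by congr (_ - _)%E; [exact: muT|rewrite setTI].
  rewrite -(fineK muKfin) in hK *.
  by move: hK; rewrite -!EFinB !lte_fin => hK; lra.
have {}hde := hde _ (measurableC mK) muKC.
have [|y Ky|F finF KF] := cK X (fun y => [set t | d y t < e / 2]).
- by move=> y; exact: mopen_ball.
- by exists y => //=; rewrite (distxx dm).
have [s sF] := (finite_seqP _).1 finF.
pose k (t : borel d) : 'I_(size s).+1 := inord (first_ball (e / 2) s t).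
(* The label [size s] falls outside the list and selects the default [x0]. *)
pose x (i : 'I_(size s).+1) := nth x0 s i.
have kE t : k t = first_ball (e / 2) s t :> nat.
  by rewrite /k inordK// ltnS /first_ball find_size.
have mk : measurable_label k.
  move=> i; rewrite (_ : _ @^-1` _ = first_ball (e / 2) s @^-1` [set (i : nat)]).
    exact: measurable_first_ball.
  apply/seteqP; split => t /=; first by move=> <-; rewrite kE.
  by move=> h; apply/val_inj; rewrite /= kE.
have [z hz] := finite_bary_exists dm dc cb (label_law_ge0 mu k)
  (label_law_sum muT mk) x.
exists z, (size s).+1, k, x; split=> //.
pose KC : set (borel d) := ~` K; pose h := (d x0 : borel d -> R) \_ KC.
have hE t : h t = if t \in KC then d x0 t else 0 by [].
have mfK : measurable_fun setT (EFin \o h).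
  apply/measurable_EFinP; apply/(measurable_restrictT _ _).1; first exact: measurableC.
  exact: measurable_funTS.
apply: (@le_trans _ _ (\int[mu]_t ((e / 2)%:E + (h t)%:E))%E).
  apply: ge0_le_integral => //.
  - by move=> t _; rewrite lee_fin dist_ge0.
  - exact: measurable_dist_label.
  - by apply: emeasurable_funD => //; exact: measurable_cst.
  - move=> t _; rewrite -EFinD lee_fin /x kE.
    have [hs|hs] := boolP (has (fun y => d y t < e / 2) s).
      have := nth_find x0 hs; rewrite -/(first_ball (e / 2) s t) (distC dm t).
      move=> /ltW ht; apply: le_trans ht _; rewrite lerDl hE.
      by case: ifP => // _; rewrite dist_ge0.
    rewrite nth_default; last by rewrite leqNgt -has_find.
    rewrite (distC dm t) hE mem_set ?lerDr ?ltW//= => Kt.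
    have [y Fy /= yt] := KF _ Kt; move/hasPn : hs => /(_ y).
    by rewrite yt /=; move: Fy; rewrite sF /= => ->; move/(_ isT).
rewrite ge0_integralD//; first last.
- by move=> t _; rewrite lee_fin hE; case: ifP => // _; rewrite dist_ge0.
- by move=> t _; rewrite lee_fin ltW.
rewrite integral_cst// muT mule1 [e in leRHS]splitr EFinD leeD2l//.
have -> : (\int[mu]_t (h t)%:E = \int[mu]_(t in KC) (d x0 t)%:E)%E.
  by rewrite [RHS]integral_mkcond restrict_EFin.
have hKC : fine (\int[mu]_(t in KC) (d x0 t)%:E) < e / 2.
  apply: le_lt_trans hde; rewrite /Rintegral le_eqVlt; apply/orP; left; apply/eqP.
  by congr fine; apply: eq_integral => t _; rewrite ger0_norm// dist_ge0.
have ifin : (\int[mu]_(t in KC) (d x0 t)%:E)%E \is a fin_num.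
  rewrite ge0_fin_numE; last by apply: integral_ge0 => t _; rewrite lee_fin dist_ge0.
  apply: le_lt_trans fin; apply: ge0_subset_integral => //.
  - exact: measurableC.
  - exact/measurable_EFinP.
  - by move=> t _; rewrite lee_fin dist_ge0.
by rewrite -(fineK ifin) lee_fin ltW.
Qed.

(** Approximate barycenters with errors [1 / n.+1] form a Cauchy sequence by [approx_bary_dist]. *)
Lemma is_bary_exists mu : P1 mu -> exists z, is_bary mu z.
Proof.
move=> hmu; have muT : mu setT = 1%E by case: hmu => -[].
have e0 n : 0 < n.+1%:R^-1 :> R by rewrite invr_gt0.
have [z hz] := choice (fun n => P1_approx_bary hmu (e0 n)).
have small (e : R) : 0 < e -> exists N, forall n, (N <= n)%N -> n.+1%:R^-1 < e / 2.
  move=> ep; have e2 : 0 < e / 2 by rewrite divr_gt0.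
  exists (Num.bound (e / 2)^-1) => n Nn.
  rewrite invf_plt ?posrE//; apply: lt_le_trans (archi_boundP _) _.
    by rewrite invr_ge0 ltW.
  by rewrite ler_nat leqW.
have dz m n := approx_bary_dist muT (hz m) (hz n).
have [|l hl] := @dc z.
  move=> e /small[N hN]; exists N => m n /hN Nm /hN Nn.
  by apply: le_lt_trans (dz m n) _; rewrite [e]splitr ltrD.
exists l => e ep; have [N hN] := small _ ep; have [N' hN'] := hl _ ep.
pose n := maxn N N'; exists (z n); last first.
  by rewrite (distC dm) ltW// hN'// leq_maxr.
have [m [k [x [mk hx he]]]] := hz n; exists m, k, x; split=> //.
apply: le_trans he _; rewrite lee_fin.
by have := hN _ (leq_maxl N N'); rewrite -/n => h; apply: le_trans (ltW h) _; lra.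
Qed.

End MeasureBarycenter.

(** * Bicombing of a barycenter map *)

Section PointMasses.
Variables (R : realType) (Y : pointedType) (e : Y -> Y -> R).

(** [mscale] asks for a nonnegative scalar; the absolute value provides one for any [w] and
    disappears once the weights are nonnegative. *)
Definition point_masses n (w : nat -> R) (y : nat -> Y)
    : {measure set (borel e) -> \bar R} :=
  msum (fun i => mscale (NngNum (normr_ge0 (w i))) (dirac (y i : borel e))) n.

(** A property rather than an equality with [point_masses], as one law is later written with
    different splittings of its masses. *)
Definition has_masses (mu : {measure set (borel e) -> \bar R})
    n (w : nat -> R) (y : nat -> Y) :=
  forall A : set Y, mu A = (\sum_(i < n) w i * (y i \in A)%:R)%:E.

Lemma point_massesP n (w : nat -> R) y : (forall i, 0 <= w i) ->
  has_masses (point_masses n w y) n w y.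
Proof.
move=> w0 A; rewrite /point_masses /= /msum -sumEFin; apply: eq_bigr => i _.
by rewrite -[LHS]/(_ * dirac (y i : borel e) A)%E diracE -EFinM /= ger0_norm.
Qed.

Lemma mcompact_finite (K : set Y) : finite_set K -> mcompact e K.
Proof.
(* An empty [K] is treated apart, since [I] may then be empty. *)
move=> finK I U _ KU; have [K0|/existsNP[y0 Ky0]] := pselect (forall y, ~ K y).
  by exists set0 => // y /K0.
have [i0 _ _] := KU _ (contrapT Ky0).
have [y|f fP] := @choice _ _ (fun y i => K y -> U i y).
  have [/KU[i _ Uy]|nKy] := pselect (K y); first by exists i.
  by exists i0.
exists (f @` K); first exact: finite_image.
by move=> y Ky; exists (f y); [exists y|exact: fP].
Qed.

(** The atoms lying in [B] form a finite, hence compact, set with the full mass of [B]. *)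
Lemma has_masses_radon mu n (w : nat -> R) y : (forall i, 0 <= w i) ->
  \sum_(i < n) w i = 1 -> has_masses mu n w y -> radon_prob mu.
Proof.
move=> w0 w1 muE; split.
  by rewrite muE; congr EFin; rewrite -[RHS]w1; apply: eq_bigr => i _; rewrite in_setT mulr1.
move=> B mB; apply/eqP; rewrite eq_le; apply/andP; split.
  pose K : set Y := B `&` (y @` `I_n).
  apply: ereal_sup_ubound; exists K.
    split; last by move=> t [].
    by apply/mcompact_finite/finite_setIr/finite_image; exact: finite_II.
  rewrite !muE; congr EFin; apply: eq_bigr => i _; congr (_ * _%:R).
  rewrite /K in_setI; suff -> : y i \in y @` `I_n by rewrite andbT.
  by rewrite inE; exists i => /=.
apply: ge_ereal_sup => _ [K [_ KB] <-].
rewrite !muE lee_fin; apply: ler_sum => i _; apply: ler_wpM2l => //.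
rewrite ler_nat; have [/set_mem/KB yB|//] := boolP (y i \in K).
by rewrite mem_set.
Qed.

Lemma integral_point_masses n (w : nat -> R) y (f : borel e -> R) : (forall i, 0 <= w i) ->
  measurable_fun setT f -> (forall t, 0 <= f t) ->
  (\int[point_masses n w y]_t (f t)%:E = (\sum_(i < n) w i * f (y i))%:E)%E.
Proof.
move=> w0 mf f0; rewrite /point_masses ge0_integral_measure_sum//; last 2 first.
- by move=> t _; rewrite lee_fin.
- exact/measurable_EFinP.
rewrite -sumEFin; apply: eq_bigr => i _.
rewrite ge0_integral_mscale//; last 2 first.
- exact/measurable_EFinP.
- by move=> t _; rewrite lee_fin.
rewrite integral_dirac//; last exact/measurable_EFinP.
by rewrite diracT mul1e/= ger0_norm// EFinM.
Qed.

End PointMasses.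

(** * Geodesics from two-point laws *)

Section BicombingOfBarycenter.
Variables (R : realType) (X : pointedType) (d : X -> X -> R).
Hypothesis dm : is_metric d.

Lemma has_masses_P1 (mu : {measure set (borel d) -> \bar R}) n
    (w : nat -> R) x :
  (forall i, 0 <= w i) -> \sum_(i < n) w i = 1 -> has_masses mu n w x -> P1 mu.
Proof.
move=> w0 w1 muE; split; first exact: has_masses_radon muE.
exists point; rewrite (eq_measure_integral (point_masses d n w x)); last first.
  by move=> A _ _; rewrite muE point_massesP.
rewrite integral_point_masses// ?ltry//; first exact: measurable_dist.
exact: dist_ge0.
Qed.

Variable beta : {measure set (borel d) -> \bar R} -> X.
Hypothesis hbeta : contracting_barycenter_map beta.

(** The right-hand side is the cost of the coupling that sends the [i]-th mass of [mu] to the [i]-th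
    mass of [nu]. *)
Lemma barycenter_masses_dist n (w : nat -> R) (x y : nat -> X) mu nu :
  (forall i, 0 <= w i) -> \sum_(i < n) w i = 1 ->
  has_masses mu n w x -> has_masses nu n w y ->
  d (beta mu) (beta nu) <= \sum_(i < n) w i * d (x i) (y i).
Proof.
move=> w0 w1 muE nuE; rewrite -lee_fin.
apply: le_trans (hbeta.2 mu nu (has_masses_P1 w0 w1 muE) (has_masses_P1 w0 w1 nuE)) _.
pose g := point_masses (dprod d) n w (fun i => (x i, y i)).
have gE := point_massesP (dprod d) n (fun i => (x i, y i)) w0.
have cg : coupling mu nu g.
  split; first exact: has_masses_radon gE.
  split=> A mA; rewrite ?muE ?nuE gE; congr EFin; apply: eq_bigr => i _;
    by congr (_ * _%:R); apply/idP/idP; rewrite !inE.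
apply: ereal_inf_lbound; exists g => //.
rewrite (integral_point_masses n _ (f := fun p : borel (dprod d) => d p.1 p.2))//.
  exact: measurable_dist2.
by move=> p; exact: dist_ge0.
Qed.

Definition barycenter_bicombing x y t : X :=
  beta (point_masses d 2 (fun i => if i is 0 then 1 - t else t)
                         (fun i => if i is 0 then x else y)).

Lemma has_masses2 x y t : 0 <= t <= 1 ->
  has_masses (point_masses d 2 (fun i => if i is 0 then 1 - t else t)
                               (fun i => if i is 0 then x else y))
    2 (fun i => if i is 0 then 1 - t else t) (fun i => if i is 0 then x else y).
Proof. by move=> t01; apply: point_massesP => -[|i]; lra. Qed.

Lemma barycenter_bicombing_conical x y x' y' t : 0 <= t <= 1 ->
  d (barycenter_bicombing x y t) (barycenter_bicombing x' y' t) <=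
  (1 - t) * d x x' + t * d y y'.
Proof.
move=> t01.
have := barycenter_masses_dist _ _ (has_masses2 x y t01) (has_masses2 x' y' t01).
rewrite !big_ord_recl !big_ord0 /= !addr0; apply; last by ring.
by move=> -[|i]; lra.
Qed.

(** Splitting a point mass in two makes it ready to be matched with a two-point law. *)
Lemma has_masses_dirac x t :
  has_masses (\d_(x : borel d)) 2 (fun i => if i is 0 then 1 - t else t) (fun=> x).
Proof.
by move=> A; rewrite -[LHS]/(dirac (x : borel d) A) diracE !big_ord_recl big_ord0 /=; congr EFin; ring.
Qed.

Lemma barycenter_bicombing0 x y : barycenter_bicombing x y 0 = x.
Proof.
have t01 : 0 <= (0 : R) <= 1 by lra.
apply: (dist_eq0 dm); apply/eqP; rewrite eq_le (dist_ge0 dm) andbT.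
rewrite -[X in d _ X](hbeta.1 x).
have := barycenter_masses_dist _ _ (has_masses2 x y t01) (has_masses_dirac x 0).
rewrite !big_ord_recl !big_ord0 /= (distxx dm) mulr0 mul0r !addr0; apply; last by ring.
by move=> -[|i]; lra.
Qed.

Lemma barycenter_bicombing1 x y : barycenter_bicombing x y 1 = y.
Proof.
have t01 : 0 <= (1 : R) <= 1 by lra.
apply: (dist_eq0 dm); apply/eqP; rewrite eq_le (dist_ge0 dm) andbT.
rewrite -[X in d _ X](hbeta.1 y).
have := barycenter_masses_dist _ _ (has_masses2 x y t01) (has_masses_dirac y 1).
rewrite !big_ord_recl !big_ord0 /= (distxx dm) => h.
by apply: le_trans (h _ _) _; [move=> -[|i]; lra|ring|lra].
Qed.

Lemma barycenter_bicombing_le x y s t : 0 <= s -> s <= t -> t <= 1 ->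
  d (barycenter_bicombing x y s) (barycenter_bicombing x y t) <= (t - s) * d x y.
Proof.
move=> s0 st t1.
(* Common splitting of the two laws: only the middle mass [t - s] moves, from [x] to [y]. *)
pose w (i : nat) := match i with 0 => 1 - t | 1 => t - s | _ => s end.
have hs : has_masses (point_masses d 2 (fun i => if i is 0 then 1 - s else s)
    (fun i => if i is 0 then x else y)) 3 w
    (fun i => match i with 0 => x | 1 => x | _ => y end).
  move=> A; rewrite has_masses2; last by lra.
  by rewrite !big_ord_recl !big_ord0 /=; congr EFin; ring.
have ht : has_masses (point_masses d 2 (fun i => if i is 0 then 1 - t else t)
    (fun i => if i is 0 then x else y)) 3 w
    (fun i => match i with 0 => x | 1 => y | _ => y end).
  move=> A; rewrite has_masses2; last by lra.
  by rewrite !big_ord_recl !big_ord0 /=; congr EFin; ring.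
have := barycenter_masses_dist _ _ hs ht.
rewrite !big_ord_recl !big_ord0 /= !(distxx dm) !mulr0 add0r !addr0; apply; last by ring.
by move=> -[|[|i]]; rewrite /w; lra.
Qed.

(** The upper bounds on [[0, s]], [[s, t]] and [[t, 1]] add up to [d x y], so the triangle
    inequality makes each of them an equality. *)
Lemma barycenter_bicombing_dist x y s t : 0 <= s -> s <= t -> t <= 1 ->
  d (barycenter_bicombing x y s) (barycenter_bicombing x y t) = (t - s) * d x y.
Proof.
move=> s0 st t1; apply/eqP; rewrite eq_le barycenter_bicombing_le//=.
have := barycenter_bicombing_le x y (lexx 0) s0 (le_trans st t1).
have := barycenter_bicombing_le x y (le_trans s0 st) t1 (lexx 1).
rewrite barycenter_bicombing0 barycenter_bicombing1.
set a := barycenter_bicombing x y s; set b := barycenter_bicombing x y t.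
have := dist_triangle dm a x y; have := dist_triangle dm b a y; lra.
Qed.

Lemma barycenter_bicombingP : conical_bicombing d barycenter_bicombing.
Proof.
split; last exact: barycenter_bicombing_conical.
move=> x y; split; first exact: barycenter_bicombing0.
split; first exact: barycenter_bicombing1.
move=> s t /andP[s0 s1] /andP[t0 t1]; have [st|/ltW ts] := leP s t.
  by rewrite barycenter_bicombing_dist// distrC ger0_norm// subr_ge0.
by rewrite (distC dm) barycenter_bicombing_dist// ger0_norm// subr_ge0.
Qed.

End BicombingOfBarycenter.

Theorem theorem1p2 (R : realType) (X : pointedType) (d : X -> X -> R) :
  is_metric d -> is_complete d ->
  ((exists sigma : X -> X -> R -> X, conical_bicombing d sigma) <->
   barycentric d).
Proof.
move=> dm dc; split=> [[sigma cb]|[beta hbeta]]; last first.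
  by exists (barycenter_bicombing beta); exact: barycenter_bicombingP.
(* Where no barycenter exists the value is [point]; by [is_bary_exists] this does not happen on
   [P1]. *)
pose beta (mu : {measure set (borel d) -> \bar R}) := xget point [set z | is_bary sigma mu z].
have betaP mu : P1 mu -> is_bary sigma mu (beta mu).
  by move=> /(is_bary_exists dm dc cb) ex; exact: (xgetPex point).
exists beta; split=> [x|mu nu /betaP hmu /betaP hnu].
  apply: (is_bary_dirac dm dc cb); apply: betaP.
  apply: (@has_masses_P1 _ _ _ dm _ 2 (fun i => if i is 0 then 1 - 0 else 0) (fun=> x)).
  - by move=> -[|i]; lra.
  - by rewrite !big_ord_recl big_ord0 /=; ring.
  - exact: has_masses_dirac.
exact: (is_bary_lipschitz dm dc cb).
Qed.
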